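(* Let $\mathcal{A}$ be a $\sigma$-algebra over a nonempty set $X$, and let $\mu$ and $\nu$ be finite measures on $\mathcal{A}$. Then $\mu$ splits uniquely into $\mu_{\mathrm{ac}}\ll\nu$ and $\mu_{\mathrm{s}}\perp\nu$; that is, there exists a unique pair of measures $\mu_{\mathrm{ac}},\mu_{\mathrm{s}}$ on $\mathcal{A}$ such that $\mu=\mu_{\mathrm{ac}}+\mu_{\mathrm{s}}$, $\mu_{\mathrm{ac}}\ll\nu$ and $\mu_{\mathrm{s}}\perp\nu$.
   Context: Finite measures on $\mathcal{A}$ are countably additive set functions $\mathcal{A}\to\mathbb{R}_+$, where $\mathbb{R}_+$ denotes the nonnegative real numbers. For measures $\alpha,\beta$ on $\mathcal{A}$: $\alpha\leq\beta$ ($\alpha$ is dominated by $\beta$) means $\alpha(A)\leq\beta(A)$ for all $A\in\mathcal{A}$; $\alpha\ll\beta$ ($\alpha$ is $\beta$-absolutely continuous) means that $\beta(A)=0$ implies $\alpha(A)=0$ for all $A\in\mathcal{A}$; $\alpha\perp\beta$ (singularity) means that the only measure dominated by both $\alpha$ and $\beta$ is the zero measure, which is equivalent to the existence of a set $P\in\mathcal{A}$ with $\alpha(P)=\beta(X\setminus P)=0$. *)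

(* Defs.v *)
From HB Require Import structures.
From mathcomp Require Import all_boot all_order all_algebra.
From mathcomp Require Import all_classical all_reals all_analysis.

Set Implicit Arguments.
Unset Strict Implicit.
Unset Printing Implicit Defensive.

Local Open Scope classical_set_scope.
Local Open Scope ring_scope.
Local Open Scope ereal_scope.

(* A measure is a function on all of [set T] whose values outside the
   sigma-algebra are arbitrary (nonnegative), so the order, the sum and the equality
   of measures are all read on measurable sets only. *)

Definition measure_le (d : measure_display) (T : measurableType d)
    (R : realType) (alpha beta : {measure set T -> \bar R}) : Prop :=
  forall A, measurable A -> alpha A <= beta A.

Definition measure_eq (d : measure_display) (T : measurableType d)
    (R : realType) (alpha beta : {measure set T -> \bar R}) : Prop :=
  forall A, measurable A -> alpha A = beta A.

Definition singular (d : measure_display) (T : measurableType d)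
    (R : realType) (alpha beta : {measure set T -> \bar R}) : Prop :=
  forall gamma : {measure set T -> \bar R},
    measure_le gamma alpha -> measure_le gamma beta -> measure_eq gamma mzero.

(* [content_dominates nu mu_ac] reads "mu_ac is nu-absolutely continuous":
   the dominating measure comes first. *)
Definition lebesgue_decomposition (d : measure_display) (T : measurableType d)
    (R : realType) (mu nu mu_ac mu_s : {measure set T -> \bar R}) : Prop :=
  [/\ forall A, measurable A -> mu A = mu_ac A + mu_s A,
      content_dominates nu mu_ac
    & singular mu_s nu].

(* Main.v *)
(**
  Among the [nu]-null sets choose one, [N], of maximal [mu]-measure: every
  [nu]-null set is then [mu]-null outside [N], so that the restrictions of [mu]
  to the complement of [N] and to [N] form a decomposition.  Any other
  decomposition [(a, s)] has [a N = 0], while the restriction of [s] to the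
  complement of [N] is both singular and absolutely continuous with respect to
  [nu], hence zero by the Hahn decomposition of [k s - nu] for all [k].
*)
Require Import Defs.
From HB Require Import structures.
From mathcomp Require Import all_boot all_order all_algebra.
From mathcomp Require Import all_classical all_reals all_analysis.

Local Open Scope classical_set_scope.
Local Open Scope ring_scope.
Local Open Scope ereal_scope.

Import Order.TTheory GRing.Theory Num.Theory.

(** The supremum of [mu] over [nu]-null sets is attained: the union of a maximizing sequence of null
    sets is again null, by countable subadditivity. *)
Lemma maximal_null_set (R : realType) (d : measure_display)
    (X : measurableType d) (mu nu : {finite_measure set X -> \bar R}) :
  exists N, [/\ measurable N, nu N = 0 &
    forall A, measurable A -> nu A = 0 -> mu (A `\` N) = 0].
Proof.
pose S := [set mu A | A in [set A | measurable A /\ nu A = 0]].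
have /ereal_sup_seq[u Su u_sup] : S != set0.
  by apply/set0P; exists (mu set0), set0; rewrite /= ?measure0.
have /choice[F F_prop] : forall n, exists A,
    [/\ measurable A, nu A = 0 & mu A = u n].
  by move=> n; have [A [mA A0] Au] := Su n; exists A.
have mF n : measurable (F n) by have [] := F_prop n.
pose N := \bigcup_n F n.
have mN : measurable N by exact: bigcup_measurable.
have nuN0 : nu N = 0.
  apply/(negligibleP _ mN)/negligible_bigcup => n.
  by apply/(negligibleP _ (mF n)); have [] := F_prop n.
have supN : ereal_sup S <= mu N.
  rewrite -(cvg_lim _ u_sup)//; apply: lime_le.
    by apply/cvg_ex; exists (ereal_sup S).
  apply: nearW => n; have [_ _ <-] := F_prop n.
  by rewrite le_measure ?inE//; exact: bigcup_sup.
exists N; split=> // A mA nuA0.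
have mAN : measurable (A `\` N) by exact: measurableD.
(* The enlarged set is still [nu]-null, so it competes in [S]; since [mu N] is finite, it cancels
   and leaves [mu (A \ N) <= 0]. *)
have : mu (N `|` (A `\` N)) <= mu N.
  apply: le_trans supN; apply: ereal_sup_ubound; exists (N `|` (A `\` N)) => //.
  split; first exact: measurableU.
  by rewrite measureU0//; exact: (subset_measure0 mAN mA (@subDsetl _ _ _)).
rewrite measureU ?setDIK//.
rewrite -[leRHS]adde0 leeD2lE ?fin_num_measure//.
by rewrite measure_le0 => /eqP.
Qed.

(** With [k = n + 1], the positive set [P] of [k al - be] is null for both measures, so [al] lives
    on the negative set, where [k al <= be]. Thus [k al setT] stays bounded as [k] grows. *)
Lemma singular_dominated_eq0 (R : realType) (d : measure_display)
    (X : measurableType d) (al be : {finite_measure set X -> \bar R}) :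
  singular al be -> content_dominates be al -> al setT = 0.
Proof.
move=> albe beal.
have bound n : n.+1%:R%:E * al setT <= be setT.
  pose sigma : {charge set X -> \bar R} :=
    cadd (cscale n.+1%:R (charge_of_finite_measure al))
         (cscale (-1) (charge_of_finite_measure be)).
  have sigmaE A : measurable A -> sigma A = n.+1%:R%:E * al A - be A.
    by move=> mA; rewrite /sigma/= /cadd/= /cscale EFinN mulN1e.
  have [P [M [[mP posP] [mM negM] PM PM0]]] := Hahn_decomposition sigma.
  have k0 : (0 <= n.+1%:R^-1 :> R)%R by [].
  (* The factor [1/k <= 1] keeps [gamma] below [be], and positivity of [P] puts it below [al];
     singularity then forces [be P = 0]. *)
  pose gamma := mscale (NngNum k0) (mrestr be mP).
  have g_be : measure_le gamma be.
    move=> A mA; rewrite /gamma/= /mscale /mrestr/= -[leRHS]mul1e.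
    rewrite lee_pmul ?lee_fin ?invf_le1 ?ler1n//.
    exact: measureIl.
  have g_al : measure_le gamma al.
    move=> A mA; have mAP : measurable (A `&` P) by exact: measurableI.
    apply: le_trans (measureIl al mA mP).
    have := posP _ mAP (@subIsetr _ _ _).
    rewrite sigmaE// sube_ge0 ?fin_num_measure//.
    by rewrite /gamma/= /mscale /mrestr/= lee_pdivrMl.
  have beP : be P = 0.
    have /eqP : n.+1%:R^-1%:E * be (P `&` P) = 0 := albe _ g_al g_be P mP.
    by rewrite setIid mule_eq0 eqe invr_eq0 pnatr_eq0/= => /eqP.
  have alP : al P = 0 by exact: beal.
  have -> : al setT = al M by rewrite -PM measureU// -[RHS]add0e -alP.
  apply: (@le_trans _ _ (be M)); last by rewrite le_measure ?inE.
  have := negM _ mM (@subset_refl _ _).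
  by rewrite sigmaE// sube_le0 ?fin_num_measure.
have bT : be setT \is a fin_num by exact: fin_num_measure.
have aT : al setT \is a fin_num by exact: fin_num_measure.
apply/eqP; rewrite eq_le measure_ge0 andbT leNgt; apply/negP => aT0.
(* For this [n], [n + 1] strictly exceeds the ratio of [be setT] to [al setT], against [bound]. *)
have := bound (Num.truncn (fine (be setT) / fine (al setT))).
apply/negP; rewrite -ltNge -(fineK bT) -(fineK aT) -EFinM lte_fin.
by rewrite -ltr_pdivrMr ?truncnS_gt// fine_gt0// aT0 ltey_eq aT.
Qed.

Theorem mainTheorem2 (R : realType) (d : measure_display)
    (X : measurableType d) (mu nu : {finite_measure set X -> \bar R}) :
  exists mu_ac mu_s : {measure set X -> \bar R},
    lebesgue_decomposition mu nu mu_ac mu_s /\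
    (forall mu_ac' mu_s' : {measure set X -> \bar R},
       lebesgue_decomposition mu nu mu_ac' mu_s' ->
       measure_eq mu_ac' mu_ac /\ measure_eq mu_s' mu_s).
Proof.
have [N [mN nuN0 muN]] := maximal_null_set _ _ _ mu nu.
have mCN : measurable (~` N) by exact: measurableC.
exists (mrestr mu mCN), (mrestr mu mN); split.
  split=> [A mA|A mA nuA0|ga ga_mu ga_nu A mA].
  - by rewrite /= /mrestr -setDE -measureDI.
  - by rewrite /= /mrestr -setDE muN.
  (* [ga] vanishes off [N] by its bound by [mu] restricted to [N], and on [N] because [nu N = 0]. *)
  - rewrite /mzero (measureDI ga mA mN).
    have mAN := measurableD mA mN; have mAIN := measurableI _ _ mA mN.
    have := ga_mu _ mAN.
    rewrite /= /mrestr setDKI measure0 measure_le0 => /eqP ->.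
    rewrite add0e; apply: (subset_measure0 _ mN (@subIsetr _ _ _)) => //.
    by apply/eqP; rewrite -measure_le0 -nuN0; exact: ga_nu.
move=> a s [mu_as nu_a s_nu].
have s_mu A : measurable A -> s A <= mu A.
  by move=> mA; rewrite mu_as// leeDr.
(* The competitor [s] is not assumed finite; its finiteness comes from [s <= mu]. *)
have sCN_fin : s (~` N) < +oo.
  by rewrite (le_lt_trans (s_mu _ mCN))// -ge0_fin_numE// fin_num_measure.
have sCN0 : s (~` N) = 0.
  rewrite -[X in s X]setTI.
  apply: (@singular_dominated_eq0 _ _ _ (mfrestr mCN sCN_fin) nu).
    move=> ga ga_s ga_nu; apply: s_nu => // A mA.
    exact: le_trans (ga_s A mA) (measureIl s mA mCN).
  move=> A mA nuA0; apply/eqP; rewrite -measure_le0 -(muN _ mA nuA0) setDE.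
  by apply: s_mu; exact: measurableI.
have aN0 : a N = 0 by exact: nu_a.
have s_out A : measurable A -> s (A `&` ~` N) = 0.
  move=> mA; have mAN := measurableI _ _ mA mCN.
  by apply: (subset_measure0 mAN mCN (@subIsetr _ _ _)).
have a_in A : measurable A -> a (A `&` N) = 0.
  move=> mA; have mAN := measurableI _ _ mA mN.
  by apply: (subset_measure0 mAN mN (@subIsetr _ _ _)).
(* On each side of [N] only one of [a] and [s] survives in [mu = a + s], so the restrictions of [mu]
   recover them. *)
split=> A mA; rewrite /= /mrestr mu_as; try exact: measurableI.
- by rewrite s_out// -(a_in A mA) -setDE; exact: measureDI.
- by rewrite a_in// -(s_out A mA) -setDE; exact: measureDI.
Qed.
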